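(* Let $b$ and $n$ be positive integers such that $C_b(n) := nb^n+1$ is odd. If $n^{b^n}\equiv (-1)^b \pmod{C_b(n)}$, then $C_b(n)$ is a Fermat (weak) probable prime to base $n$, i.e. $$n^{C_b(n)-1}\equiv 1 \pmod{C_b(n)}.$$
   Context: The integers $C_b(n) = nb^n+1$ are called Generalized Cullen Numbers. An integer $N>1$ is a Fermat (or weak) probable prime to base $a$ if $a^{N-1}\equiv 1 \pmod N$. *)

(* Defs.v *)
From mathcomp Require Import all_boot all_order all_algebra.

Set Implicit Arguments.
Unset Strict Implicit.
Unset Printing Implicit Defensive.

Definition gen_cullen (b n : nat) : nat := (n * b ^ n + 1)%N.

(* The base is an integer, so that congruences involving -1 and congruences
   expressing probable primality live in the same ring. *)
Definition fermat_probable_prime (a : int) (N : nat) : Prop :=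
  (1 < N)%N /\ (a ^+ (N - 1)%N = 1 %[mod N%:Z])%Z.

(* Main.v *)
Require Import Defs.
From mathcomp Require Import all_boot all_order all_algebra.

(** Write [N] for [gen_cullen b n], so that [N - 1 = n * b ^ n].  Raising the
    hypothesis to the [n]-th power gives [n ^ (N - 1) = (-1) ^ (b * n)] modulo
    [N].  Since [N] is odd, [n * b ^ n] is even, hence [n] or [b] is even, and
    the sign is [1]. *)

Theorem proposition5 (b n : nat) (hb : (0 < b)%N) (hn : (0 < n)%N)
    (hodd : odd (gen_cullen b n))
    (hcong : ((n%:Z ^+ (b ^ n)%N)%R = ((-1) ^+ b)%R %[mod (gen_cullen b n)%:Z])%Z) :
  fermat_probable_prime n%:Z (gen_cullen b n).
Proof.
have even_bn : ~~ odd (b * n).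
  (* As [n] is positive, [b ^ n] has the parity of [b]. *)
  by move: hodd; rewrite /gen_cullen oddD oddM oddX oddM (gtn_eqF hn); case: (odd b); case: (odd n).
split; first by rewrite /gen_cullen addn1 ltnS muln_gt0 hn expn_gt0 hb.
have -> : gen_cullen b n - 1 = b ^ n * n by rewrite /gen_cullen addnK mulnC.
rewrite GRing.exprM -modzXm hcong modzXm -GRing.exprM.
by rewrite -GRing.signr_odd (negbTE even_bn).
Qed.
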